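(* If $\{U,P_1,\dots,P_{2^k}\}$ is a strong bent partition of $\mathbb{F}_2^n$ with $U$ a linear subspace, then the coloring of the subspace hypergraph $\mathcal{H}_n$ into $2^k+1$ colors given by the color classes $U\setminus\{\overline 0\},P_1,\dots,P_{2^k}$ is a perfect coloring.
   Context: $\overline 0$ is the zero vector. For a Boolean function $f:\mathbb{F}_2^n\to\mathbb{F}_2$, put $\widehat f(x)=\frac{1}{2^{n/2}}\sum_{z}(-1)^{f(z)+(x,z)}$, $(x,z)=x_1z_1+\dots+x_nz_n$; $f$ is bent if $\widehat f(x)=\pm1$ for all $x$. For a real-valued function $g$ on $\mathbb{F}_2^n$, $\widehat g(x)=\frac1{2^{n/2}}\sum_z g(z)(-1)^{(x,z)}$. $\chi_V$ is the indicator function of $V$; $U^\perp=\{x:(x,y)=0\ \forall y\in U\}$. A partition $\{U,P_1,\dots,P_K\}$ of $\mathbb{F}_2^n$ is a normal bent partition of depth $K$ if every Boolean function $f$ that is constant on each of $U,P_1,\dots,P_K$ and takes each value $c\in\{0,1\}$ on exactly $K/2$ of the sets $P_1,\dots,P_K$ is bent. It is known that then $K=2^k$ for some $k$, $U$ is an $n/2$-dimensional affine subspace, and all $P_i$ have size $\frac{2^n-2^{n/2}}{2^k}$; as a standing assumption, $U$ is a linear subspace. It is known that then $\widehat{\chi_{P_i}}(z)=-1/2^k$ for all $i$ if $z\in U^\perp\setminus\{\overline 0\}$; $\widehat{\chi_{P_i}}(\overline 0)=\frac{2^{n/2}-1}{2^k}$ for all $i$; and for each $z\notin U^\perp$ one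 of the following holds: (1) there is a unique index $j$ with $\widehat{\chi_{P_j}}(z)=1-1/2^k$ and $\widehat{\chi_{P_i}}(z)=-1/2^k$ for all $i\ne j$; (2) there is a unique index $j$ with $\widehat{\chi_{P_j}}(z)=1/2^k-1$ and $\widehat{\chi_{P_i}}(z)=1/2^k$ for all $i\neq j$. The normal bent partition is strong if possibility (1) holds for every $z\notin U^\perp$ (the exceptional possibility (2) is never needed). The subspace hypergraph $\mathcal{H}_n$ is the $3$-uniform hypergraph with vertex set $\mathbb{F}_2^n\setminus\{\overline 0\}$ whose hyperedges are the $3$-element sets $\{x,y,z\}$ of vertices with $x+y+z=\overline 0$. A coloring is a surjective function $f$ from the vertex set onto the set of colors; the color range of a hyperedge $e$ is the multiset $\{f(x):x\in e\}$. The coloring is perfect if for any two vertices $x,y$ of the same color, the multisets of color ranges of hyperedges incident to $x$ and of hyperedges incident to $y$ coincide. *)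

(* Defs.v *)
From HB Require Import structures.
From mathcomp Require Import all_boot all_order all_algebra.
From mathcomp Require Import finmap multiset.

Set Implicit Arguments.
Unset Strict Implicit.
Unset Printing Implicit Defensive.

Import Order.TTheory GRing.Theory Num.Theory.
Local Open Scope ring_scope.

Section FourierBent.

Variable n : nat.
Local Notation V := 'rV['F_2]_n.

Definition dot (x z : V) : 'F_2 := \sum_i x 0 i * z 0 i.

(* Exponents of -1 live in 'F_2 and are read as naturals 0 or 1 through the
   coercion of 'F_2 to nat; 2^(n/2) is (sqrt 2)^n, n being possibly odd. *)
Definition walsh (R : rcfType) (f : V -> 'F_2) (x : V) : R :=
  (Num.sqrt 2 ^+ n)^-1 * \sum_(z : V) (-1) ^+ (f z + dot x z)%R.

Definition bent (R : rcfType) (f : V -> 'F_2) : Prop :=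
  forall x : V, walsh R f x = 1 \/ walsh R f x = -1.

Definition fourier (R : rcfType) (g : V -> R) (x : V) : R :=
  (Num.sqrt 2 ^+ n)^-1 * \sum_(z : V) g z * (-1) ^+ (dot x z).

Definition indicator (R : rcfType) (A : {set V}) (x : V) : R := (x \in A)%:R.

Definition orthogonal_complement (U : {set V}) : {set V} :=
  [set x | [forall y in U, dot x y == 0]].

Definition part (K : nat) (U : {set V}) (P : 'I_K -> {set V})
  (o : option 'I_K) : {set V} := if o is Some i then P i else U.

(* The library's [partition] makes the parts nonempty, disjoint and covering;
   injectivity says that the K + 1 listed parts are distinct. *)
Definition is_partition (K : nat) (U : {set V}) (P : 'I_K -> {set V}) : Prop :=
  injective (part U P) /\ partition [set part U P o | o : option 'I_K] [set: V].

Definition constant_on (f : V -> 'F_2) (A : {set V}) : Prop :=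
  {in A &, forall x y, f x = f y}.

(* The depth must be even for "exactly K/2 of the sets" to make sense; for odd
   K the condition on [f] would otherwise be vacuous or use a rounded K/2. *)
Definition normal_bent_partition (R : rcfType) (K : nat) (U : {set V})
    (P : 'I_K -> {set V}) : Prop :=
  [/\ is_partition U P,
      ~~ odd K
    & forall f : V -> 'F_2,
        constant_on f U ->
        (forall i, constant_on f (P i)) ->
        (forall c : 'F_2, #|[set i | [forall x in P i, f x == c]]| = K./2) ->
        bent R f].

Definition strong_bent_partition (R : rcfType) (K : nat) (U : {set V})
    (P : 'I_K -> {set V}) : Prop :=
  normal_bent_partition R U P /\
  forall z : V, z \notin orthogonal_complement U ->
    exists! j : 'I_K,
      fourier (indicator R (P j)) z = 1 - K%:R^-1 /\
      forall i : 'I_K, i != j -> fourier (indicator R (P i)) z = - K%:R^-1.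

End FourierBent.

Section PerfectColoring.

Variables (T C : finType) (H : {set {set T}}) (f : T -> C).

Definition is_coloring : Prop := forall c : C, exists x : T, f x = c.

Definition color_range (e : {set T}) : {mset C}%mset :=
  seq_mset [seq f x | x <- enum e].

Definition incident_color_ranges (x : T) : {mset {mset C}}%mset :=
  seq_mset [seq color_range e | e <- enum [set e in H | x \in e]].

Definition perfect_coloring : Prop :=
  is_coloring /\
  forall x y : T, f x = f y -> incident_color_ranges x = incident_color_ranges y.

End PerfectColoring.

Section SubspaceHypergraph.

Variable n : nat.

Definition vertex : finType := {x : 'rV['F_2]_n | x != 0}.

Definition subspace_hypergraph : {set {set vertex}} :=
  [set e : {set vertex} | (#|e| == 3)%N && (\sum_(x in e) val x == 0)].

(* Colors form [option 'I_K], which has K + 1 elements: [Some i] for the class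
   P i, and [None] for the remaining vertices (see [partition_coloringE]). *)
Definition partition_coloring (K : nat) (P : 'I_K -> {set 'rV['F_2]_n})
  (x : vertex) : option 'I_K := [pick i | val x \in P i].

Lemma partition_coloringE (K : nat) (U : {set 'rV['F_2]_n})
    (P : 'I_K -> {set 'rV['F_2]_n}) (o : option 'I_K) (x : vertex) :
  is_partition U P -> (partition_coloring P x == o) = (val x \in part U P o).
Proof.
move=> [injp /and3P[/eqP covp trivp _]].
have uniq o1 o2 : val x \in part U P o1 -> val x \in part U P o2 -> o1 = o2.
  move=> x1 x2; apply: injp.
  have m o' : part U P o' \in [set part U P o | o : option 'I_K].
    exact: imset_f.
  by rewrite -(def_pblock trivp (m o1) x1) (def_pblock trivp (m o2) x2).
have [o0 xo0] : exists o', val x \in part U P o'.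
  have : val x \in cover [set part U P o | o : option 'I_K].
    by rewrite covp in_setT.
  by case/bigcupP => _ /imsetP[o' _ ->] xo'; exists o'.
have cE : partition_coloring P x = o0.
  rewrite /partition_coloring; case: pickP => [i xi | noi].
    exact: (uniq (Some i)).
  by case: o0 xo0 => // i /=; rewrite noi.
rewrite cE; apply/eqP/idP => [<- // | xo]; exact: uniq.
Qed.

End SubspaceHypergraph.

(* Main.v *)
Require Import Defs.
From mathcomp Require Import all_boot all_order all_algebra.
From mathcomp Require Import zify ring lra finmap multiset.

(** Write m = 2^(n/2), let u and p_i be the Fourier transforms of the
    indicators of U and of P_i, and let delta be the indicator of the zero
    vector.  The proof shows that delta, U \ {0} and the P_i span an algebra
    under convolution (a Schur ring of the group F_2^n); this is what a perfect
    coloring of the subspace hypergraph amounts to.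

    The known spectrum of a normal bent partition is obtained directly.  For a
    set A of half of the indices and a sign e, bentness gives
    e u(z) + S(z) = 1 or -1, where S = sum_i p_i - 2 sum_(i in A) p_i
    ([fourier_balanced]).  On the orthogonal complement of U we have u(z) > 0;
    taking both signs e then forces u(z) = 1 and S(z) = 0.  Letting A vary, all
    p_i(z) agree, and sum_i p_i + u = m delta determines them
    ([fourier_part_orth]).  Together with strongness this says that
    p_i = d_i + (m delta - 1) / K, where the d_i are indicators of pairwise
    disjoint sets of nonzero vectors ([dual_class]).

    Since the d_i are orthogonal idempotents, every p_i p_j is a linear
    combination of p_i, p_j, 1 and delta ([fourier_partM]).  Transforming back,
    for x <> 0 the number of y with y in P_i and x + y in P_j depends only on
    the part that contains x ([intersection_number]).  The counts involving
    U \ {0} follow, because the counts over all colors of x + y add up to a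
    known number ([joint_count_class]).

    Finally, an edge at x is {x, y, x + y}, and it arises from exactly two
    vectors y, so these counts determine the multiset of color ranges of the
    edges at x ([incident_count]). *)

Set Implicit Arguments.
Unset Strict Implicit.
Unset Printing Implicit Defensive.
Import Order.TTheory GRing.Theory Num.Theory.
Local Open Scope ring_scope.

(** * Characters and the Fourier transform on F_2^n *)

Section Characters.
Variables (R : rcfType) (n : nat).
Local Notation V := 'rV['F_2]_n.
Local Notation m := (Num.sqrt 2 ^+ n : R).
Implicit Types (x y z : V) (g h : V -> R).

Definition character x z : R := (-1) ^+ (dot x z).

Lemma signF2D (a b : 'F_2) : (-1) ^+ (a + b)%R = (-1) ^+ a * (-1) ^+ b :> R.
Proof. by case: a b => [[|[|//]] ?] [[|[|//]] ?] /=; rewrite ?expr0 ?expr1; ring. Qed.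

Lemma addvv x : x + x = 0.
Proof.
apply/rowP => i; rewrite !mxE.
by case: (x 0 i) => [[|[|//]] ?]; apply/val_inj.
Qed.

Lemma addvK x y : x + (x + y) = y.
Proof. by rewrite addrA addvv add0r. Qed.

Lemma dotC x z : dot x z = dot z x.
Proof. by apply: eq_bigr => i _; rewrite mulrC. Qed.

Lemma dotDr x y z : dot x (y + z) = dot x y + dot x z.
Proof. by rewrite -big_split; apply: eq_bigr => i _; rewrite !mxE mulrDr. Qed.

Lemma dot0r x : dot x 0 = 0.
Proof. by rewrite /dot big1 // => i _; rewrite mxE mulr0. Qed.

Lemma characterC x z : character x z = character z x.
Proof. by rewrite /character dotC. Qed.

Lemma characterDr x y z : character x (y + z) = character x y * character x z.
Proof. by rewrite /character dotDr signF2D. Qed.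

Lemma characterDl x y z : character (x + y) z = character x z * character y z.
Proof. by rewrite characterC characterDr !(characterC z). Qed.

Lemma character0r x : character x 0 = 1.
Proof. by rewrite /character dot0r. Qed.

Lemma sqrt2n_gt0 : 0 < m.
Proof. by rewrite exprn_gt0 // sqrtr_gt0 ltr0n. Qed.

Lemma sqr_sqrt2n : m ^+ 2 = 2 ^+ n.
Proof. by rewrite exprAC sqr_sqrtr // ler0n. Qed.

(** If x_i <> 0, translating z by the i-th unit vector changes the sign of
    every term. *)
Lemma sum_character x : \sum_z character x z = m ^+ 2 * (x == 0)%:R.
Proof.
case: eqP => [->|/eqP x0].
  rewrite (eq_bigr (fun=> 1)) => [|z _]; last by rewrite characterC character0r.
  by rewrite sumr_const card_mx mul1n card_Fp // sqr_sqrt2n natrX mulr1.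
have [i xi] : exists i, x 0 i != 0.
  by apply/existsP; rewrite -negb_forall; apply: contra x0 => /forallP x0;
     apply/eqP/rowP => i; rewrite mxE; apply/eqP.
pose e : V := delta_mx 0 i.
have xe : character x e = -1.
  rewrite /character.
  have -> : dot x e = x 0 i.
    rewrite /dot (bigD1 i) //= big1 ?addr0 => [|j ji].
      by rewrite mxE !eqxx mulr1.
    by rewrite mxE (negPf ji) andbF mulr0.
  by case: (x 0 i) xi => [[|[|//]] ?].
have : \sum_z character x z = - \sum_z character x z.
  rewrite {1}(reindex_inj (addrI e)) -sumrN; apply: eq_bigr => z _.
  by rewrite characterDr xe mulN1r.
rewrite mulr0; lra.
Qed.

Lemma fourierE g z : fourier g z = m^-1 * \sum_y g y * character z y.
Proof. by []. Qed.

(** The normalized transform is an involution; the left-hand side is m times the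
    second transform of g. *)
Lemma fourier_inversion g x : \sum_z fourier g z * character x z = m * g x.
Proof.
transitivity (m^-1 * \sum_y g y * \sum_z character (x + y) z).
  under eq_bigr do rewrite fourierE -mulrA mulr_suml.
  rewrite -mulr_sumr exchange_big; congr (_ * _); apply: eq_bigr => y _.
  rewrite mulr_sumr; apply: eq_bigr => z _.
  by rewrite characterDl [character z y]characterC; ring.
rewrite (bigD1 x) //= [X in _ + X]big1 => [|y yx]; last first.
  rewrite sum_character; case: eqP => [/(congr1 (+%R x))|]; last by rewrite !mulr0.
  by rewrite addvK addr0 => yE; rewrite yE eqxx in yx.
by rewrite sum_character addvv eqxx mulr1; field; apply: lt0r_neq0 sqrt2n_gt0.
Qed.

Lemma fourier_convolution g h x :
  \sum_z fourier g z * fourier h z * character x z = \sum_y g y * h (x + y).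
Proof.
transitivity (m^-1 * \sum_y g y * \sum_z fourier h z * character (x + y) z).
  under eq_bigr do rewrite [fourier g _]fourierE -2!mulrA mulr_suml.
  rewrite -mulr_sumr exchange_big; congr (_ * _); apply: eq_bigr => y _.
  rewrite mulr_sumr; apply: eq_bigr => z _.
  by rewrite characterDl [character z y]characterC; ring.
rewrite mulr_sumr; apply: eq_bigr => y _.
by rewrite fourier_inversion; field; apply: lt0r_neq0 sqrt2n_gt0.
Qed.

End Characters.

(** * The spectrum of a strong bent partition *)

Lemma ex_card_set (T : finType) (B : {set T}) h :
  (h <= #|B|)%N -> exists2 A : {set T}, A \subset B & #|A| = h.
Proof.
move=> hB; exists [set x in take h (enum B)].
  by apply/subsetP => x; rewrite inE => /mem_take; rewrite mem_enum.
rewrite cardsE (card_uniqP _) ?take_uniq ?enum_uniq // size_take -cardE.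
by case: ltngtP hB.
Qed.

Section Spectrum.
Variables (R : rcfType) (n K : nat) (U : {set 'rV['F_2]_n}).
Variable P : 'I_K -> {set 'rV['F_2]_n}.
Local Notation V := 'rV['F_2]_n.
Local Notation m := (Num.sqrt 2 ^+ n : R).
Local Notation u := (fourier (indicator R U)).
Local Notation p i := (fourier (indicator R (P i))).

(** The extension to all vectors of the coloring of the vertices. *)
Definition class (v : V) : option 'I_K := [pick i | v \in P i].

Lemma sign_walsh (f : V -> 'F_2) z :
  walsh R f z = fourier (R := R) (fun v => (-1) ^+ f v) z.
Proof. by congr (_ * _); apply: eq_bigr => v _; rewrite signF2D. Qed.

Section Partition.
Hypothesis partUP : is_partition U P.

Lemma part_neq0 o : part U P o != set0.
Proof.
case: partUP => _ /and3P[_ _]; apply: contraNneq => <-; exact: imset_f.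
Qed.

Lemma classE v o : (class v == o) = (v \in part U P o).
Proof.
case: partUP => injp /and3P[/eqP covp trivp _].
have uniq o1 o2 : v \in part U P o1 -> v \in part U P o2 -> o1 = o2.
  move=> v1 v2; apply: injp.
  have mem o' : part U P o' \in [set part U P o | o : option 'I_K].
    exact: imset_f.
  by rewrite -(def_pblock trivp (mem o1) v1) (def_pblock trivp (mem o2) v2).
have [o0 vo0] : exists o', v \in part U P o'.
  have : v \in cover [set part U P o | o : option 'I_K] by rewrite covp in_setT.
  by case/bigcupP => _ /imsetP[o' _ ->] vo'; exists o'.
have -> : class v = o0.
  rewrite /class; case: pickP => [i vi | noi]; first exact: (uniq (Some i)).
  by case: o0 vo0 => // i /=; rewrite noi.
by apply/eqP/idP => [<- // | vo]; apply: uniq.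
Qed.

Lemma indicator_class o v : indicator R (part U P o) v = (class v == o)%:R.
Proof. by rewrite /indicator classE. Qed.

(** A function that is constant on the parts is the combination of their
    indicators with its values as coefficients. *)
Lemma fourier_class (F : option 'I_K -> R) z :
  fourier (fun v => F (class v)) z
  = F None * u z + \sum_i F (Some i) * p i z.
Proof.
have FE v : F (class v) = F None * indicator R U v
                          + \sum_i F (Some i) * indicator R (P i) v.
  rewrite (indicator_class None); under eq_bigr do rewrite (indicator_class (Some _)).
  case: (class v) => [i|]; last by rewrite big1 ?mulr1 ?addr0 // => i; rewrite mulr0.
  rewrite (bigD1 i) //= big1 => [|j /negPf ji].
    by rewrite eqxx mulr0 mulr1 add0r addr0.
  by rewrite (inj_eq Some_inj) eq_sym ji mulr0.
rewrite !fourierE; under eq_bigr do rewrite FE mulrDl mulr_suml -mulrA.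
rewrite big_split /= mulrDr; congr (_ + _); first by rewrite -mulr_sumr mulrCA.
rewrite exchange_big mulr_sumr; apply: eq_bigr => i _.
rewrite fourierE mulrCA; congr (_ * _); rewrite mulr_sumr.
by apply: eq_bigr => v _; rewrite mulrA.
Qed.

Lemma sum_fourier_parts z : u z + \sum_i p i z = m * (z == 0)%:R.
Proof.
have := fourier_class (fun=> 1) z; rewrite mul1r.
under eq_bigr do rewrite mul1r.
move=> <-; rewrite fourierE; under eq_bigr do rewrite mul1r.
by rewrite sum_character; field; apply: lt0r_neq0 (sqrt2n_gt0 _ _).
Qed.

End Partition.

Section NormalBentPartition.
Hypothesis nbp : normal_bent_partition R U P.

Let partUP : is_partition U P. Proof. by case: nbp. Qed.

(** The bent function used here takes the value 1 on the P i with i in A, 0 on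
    the other P i, and c0 on U; w is its Walsh coefficient. *)
Lemma fourier_balanced (A : {set 'I_K}) (c0 : 'F_2) z :
    #|A| = K./2 ->
  let w := (-1) ^+ c0 * u z + (\sum_i p i z - 2 * \sum_(i in A) p i z) in
  w = 1 \/ w = -1.
Proof.
move=> cardA /=.
pose c o : 'F_2 := if o is Some i then (i \in A)%:R else c0.
have -> : (-1) ^+ c0 * u z + (\sum_i p i z - 2 * \sum_(i in A) p i z)
          = walsh R (c \o class) z.
  rewrite sign_walsh (fourier_class partUP (fun o => (-1) ^+ c o)); congr (_ + _).
  rewrite (bigID [in A]) [RHS](bigID [in A]) /=.
  have -> : \sum_(i in A) (-1) ^+ c (Some i) * p i z = - \sum_(i in A) p i z.
    by rewrite -sumrN; apply: eq_bigr => i /= ->; rewrite mulN1r.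
  have -> : \sum_(i | i \notin A) (-1) ^+ c (Some i) * p i z
            = \sum_(i | i \notin A) p i z.
    by apply: eq_bigr => i /= /negPf ->; rewrite mul1r.
  ring.
have [_ evenK bentP] := nbp; apply: bentP => [x y | i x y | a].
- by rewrite -!(classE partUP _ None) => /eqP xU /eqP yU; rewrite /= xU yU.
- by rewrite -!(classE partUP _ (Some i)) => /eqP xP /eqP yP; rewrite /= xP yP.
have aE i : [forall x in P i, (c \o class) x == a] = (c (Some i) == a).
  have [x xi] := set0Pn _ (part_neq0 partUP (Some i)).
  apply/forall_inP/idP => [/(_ x xi)|ca y].
    by move: xi; rewrite -classE //= => /eqP ->.
  by rewrite -[_ \in _](classE partUP _ (Some i)) /= => /eqP ->.
under eq_finset => i do rewrite aE.
case: a {aE} => [[|[|//]] lta].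
  have <- : #|~: A| = K./2 by have := cardsC A; rewrite card_ord cardA; lia.
  apply: eq_card => i; rewrite !inE /=.
  by case: (i \in A); rewrite -val_eqE.
rewrite -cardA; apply: eq_card => i; rewrite !inE /=.
by case: (i \in A); rewrite -val_eqE.
Qed.

(** On the orthogonal complement of U every character is 1 on U. *)
Lemma fourier_orth_gt0 z : z \in orthogonal_complement U -> 0 < u z.
Proof.
rewrite inE => /forall_inP zU.
have [x xU] := set0Pn _ (part_neq0 partUP None).
rewrite fourierE mulr_gt0 ?invr_gt0 ?sqrt2n_gt0 //.
rewrite (bigD1 x) //= /indicator xU mul1r /character (eqP (zU x xU)) expr0.
rewrite ltr_pwDl // sumr_ge0 // => y _.
by case: (boolP (y \in U)) => [/zU/eqP ->|]; rewrite ?mul1r ?mul0r.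
Qed.

(** Let S = sum_i p_i - 2 sum_(i in A) p_i.  The two signs on U give
    S + u = 1 or -1 and S - u = 1 or -1, so one of u and S vanishes and the
    other is 1 or -1. *)
Lemma fourier_orth (A : {set 'I_K}) z :
    #|A| = K./2 -> z \in orthogonal_complement U ->
  u z = 1 /\ \sum_i p i z = 2 * \sum_(i in A) p i z.
Proof.
move=> cardA /fourier_orth_gt0 u_gt0.
have := fourier_balanced 0 z cardA; have := fourier_balanced 1 z cardA.
rewrite /= expr0 expr1; move: u_gt0.
set a := u z; set b := \sum_i _; set d := \sum_(i in A) _.
by move=> a0 [h1|h1] [h2|h2]; split; lra.
Qed.

Lemma fourier_orthU z : (0 < K)%N -> z \in orthogonal_complement U -> u z = 1.
Proof.
move=> K0 zU; have [|A _ cardA] := @ex_card_set 'I_K setT K./2.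
  by rewrite cardsT card_ord; lia.
by case: (fourier_orth cardA zU).
Qed.

(** Two balanced choices that differ by exchanging i and j give the same sum
    over the chosen parts. *)
Lemma fourier_orth_eq i j z : z \in orthogonal_complement U -> p i z = p j z.
Proof.
move=> zU; have [-> //|ij] := eqVneq i j.
have [_ evenK _] := nbp.
have K2 : (K = (K./2.-1).+1 + (K./2.-1).+1)%N.
  have : (1 < K)%N by case: K i j ij => [[]//|[|//]] i j; rewrite !ord1.
  lia.
have cardC : #|~: [set i; j]| = (K./2.-1 + K./2.-1)%N.
  by have := cardsC [set i; j]; rewrite cards2 ij card_ord; lia.
have [|B /subsetP BC cardB] := @ex_card_set _ (~: [set i; j]) K./2.-1.
  by rewrite cardC leq_addr.
have iB : i \notin B by apply/negP => /BC; rewrite !inE eqxx.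
have jB : j \notin B by apply/negP => /BC; rewrite !inE eqxx orbT.
have half l : l \notin B -> \sum_i p i z = 2 * (p l z + \sum_(i in B) p i z).
  move=> lB; have [||_ ->] := @fourier_orth (l |: B) z => //.
    by rewrite cardsU1 lB cardB; lia.
  by rewrite big_setU1.
have := half i iB; have := half j jB; lra.
Qed.

Lemma fourier_part_orth i z :
  z \in orthogonal_complement U -> p i z = K%:R^-1 * (m * (z == 0)%:R - 1).
Proof.
move=> zU; have K0 : (0 < K)%N by case: i => i /=; apply: leq_ltn_trans.
rewrite -(sum_fourier_parts partUP) (fourier_orthU K0 zU) addrC addKr.
under eq_bigr => j _ do rewrite (fourier_orth_eq j i zU).
rewrite sumr_const card_ord -[p i z *+ K]mulr_natl mulKf //.
by rewrite pnatr_eq0 -lt0n.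
Qed.

End NormalBentPartition.

Lemma orthogonal_complement0 : 0 \in orthogonal_complement U.
Proof. by rewrite inE; apply/forall_inP => y _; rewrite dotC dot0r. Qed.

Section StrongBentPartition.
Hypothesis sbp : strong_bent_partition R U P.

(** The nonzero vectors outside the orthogonal complement of U are distributed
    over K disjoint dual classes: o is the index of the one that contains z, or
    [None].  The transform of P i is the indicator of the i-th dual class, up to
    a constant and a multiple of the indicator of 0. *)
Lemma dual_class z : exists2 o : option 'I_K, z == 0 -> o = None
  & forall i, p i z = (o == Some i)%:R + K%:R^-1 * (m * (z == 0)%:R - 1).
Proof.
have [nbp strong] := sbp; case: (boolP (z \in orthogonal_complement U)) => zU.
  by exists None => // i; rewrite (fourier_part_orth nbp) // add0r.
have z0 : (z == 0) = false.
  by apply: contraNF zU => /eqP ->; apply: orthogonal_complement0.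
have [j [[pj pi] _]] := strong z zU; exists (Some j); first by rewrite z0.
move=> i; rewrite z0 mulr0 sub0r mulrN1 (inj_eq Some_inj) eq_sym.
by case: eqVneq => [->|/pi ->]; rewrite ?pj ?add0r.
Qed.

(** Disjointness of the dual classes makes their indicators orthogonal
    idempotents; they are then expressed back through the p i. *)
Lemma fourier_partM i j z :
  p i z * p j z = ((i == j)%:R - K%:R^-1) * p i z - K%:R^-1 * p j z
    + ((i == j)%:R - K%:R^-1) * K%:R^-1
    + (K%:R^-1 * m * (K%:R^-1 * m - (i == j)%:R)) * (z == 0)%:R.
Proof.
have [o oz pE] := dual_class z; rewrite !pE.
have -> : (i == j)%:R = ((Some i) == Some j)%:R :> R by [].
case: (eqVneq z 0) oz => [_ ->|_ _] //=.
  by case: (_ == _) => /=; ring.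
case: (eqVneq o (Some i)) => [->|oi].
  by case: (_ == _) => /=; ring.
case: (eqVneq o (Some j)) oi => [-> /negPf oi|_ _].
  by rewrite eq_sym oi /=; ring.
by case: (_ == _) => /=; ring.
Qed.

(** Convolution becomes a product under the transform, and by [fourier_partM]
    the product is a combination of functions with known inverse transforms. *)
Lemma intersection_number i j x : x != 0 ->
  \sum_y indicator R (P i) y * indicator R (P j) (x + y)
  = ((i == j)%:R - K%:R^-1) * m * indicator R (P i) x
    - K%:R^-1 * m * indicator R (P j) x
    + K%:R^-1 * m * (K%:R^-1 * m - (i == j)%:R).
Proof.
move=> /negPf x0; rewrite -fourier_convolution.
pose a : R := (i == j)%:R - K%:R^-1; pose b : R := K%:R^-1.
pose c : R := b * m * (b * m - (i == j)%:R); rewrite -/a -/b -/c.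
transitivity (\sum_z (a * (p i z * character R x z)
    + - b * (p j z * character R x z) + a * b * character R x z
    + c * ((z == 0)%:R * character R x z))).
  by apply: eq_bigr => z _; rewrite fourier_partM -/a -/b -/c; ring.
rewrite !big_split /= -!mulr_sumr !fourier_inversion sum_character x0.
rewrite (bigD1 0) //= big1 => [|z /negPf ->]; last by rewrite mul0r.
by rewrite eqxx character0r /=; ring.
Qed.

End StrongBentPartition.
End Spectrum.

(** * Color counts and color ranges in the subspace hypergraph *)

Section Hypergraph.
Variables (n : nat) (C : finType) (col : 'rV['F_2]_n -> C).
Local Notation V := 'rV['F_2]_n.
Implicit Types (b c : C) (x y : V).

(** Each y counted here gives the edge {x, y, x + y}; an edge with two distinct
    colors b and c besides x is counted once, one with b = c is counted twice. *)
Definition joint_count b c x : nat :=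
  (\sum_(y | (y != 0%R) && (y != x)) ((col y == b) && (col (x + y)%R == c)))%N.

Lemma addv_eq0 x y : (x + y == 0) = (y == x).
Proof. by rewrite -(inj_eq (addrI x)) addvK addr0. Qed.

Lemma addv_eql x y : (x + y == x) = (y == 0).
Proof. by rewrite -(inj_eq (addrI x)) addvK addvv. Qed.

Lemma joint_countC b c x : joint_count b c x = joint_count c b x.
Proof.
rewrite /joint_count (reindex_inj (addrI x)); apply: eq_big => y.
  by rewrite addv_eq0 addv_eql andbC.
by move=> _; rewrite addvK andbC.
Qed.

(** The term for [col x == b] accounts for y = x, whose partner x + y is zero
    and therefore no vertex. *)
Lemma sum_joint_count b x : x != 0 ->
  (\sum_c joint_count b c x + (col x == b) = \sum_(y : V | y != 0%R) (col y == b))%N.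
Proof.
move=> x0; rewrite [RHS](bigD1 x) //= addnC; congr (_ + _)%N.
rewrite /joint_count exchange_big; apply: eq_bigr => y _.
rewrite (bigD1 (col (x + y))) //= eqxx andbT big1 ?addn0 // => c /negPf.
by rewrite eq_sym => ->; rewrite andbF.
Qed.

Lemma mset_countE (T : finType) (D : choiceType) (A : {set T}) (g : T -> D) M :
  seq_mset [seq g e | e <- enum A] M = (\sum_(e in A) (g e == M))%N.
Proof.
rewrite mset_seqE -sum1_count big_map big_enum_cond.
by rewrite big_mkcondr; apply: eq_bigr => e _ /=; case: (g e == M).
Qed.

Let f (v : vertex n) : C := col (val v).

(** Two distinct points lie on exactly one line. *)
Lemma lineP (x y : vertex n) : y != x ->
  exists2 w : vertex n, val w = val x + val y & forall e,
   [&& e \in subspace_hypergraph n, x \in e & y \in e] = (e == [set x; y; w]).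
Proof.
move=> yx; have w0 : val x + val y != 0 by rewrite addv_eq0 (inj_eq val_inj).
pose w : vertex n := Sub (val x + val y) w0; have wE : val w = val x + val y by [].
exists w => // e.
have wx : w != x.
  by rewrite -(inj_eq val_inj) wE addv_eql (valP y).
have wy : w != y.
  by rewrite -(inj_eq val_inj) wE addrC addv_eql (valP x).
have sumE (v : vertex n) : v != x -> v != y ->
    \sum_(t in [set x; y; v]) val t = val x + val y + val v.
  move=> vx vy; rewrite setUC big_setU1 ?inE ?(negPf vx) ?(negPf vy) //=.
  by rewrite big_setU1 ?inE 1?eq_sym //= big_set1 addrC.
apply/idP/eqP => [/and3P[+ xe ye]|->].
  rewrite inE => /andP[/eqP e3 e0].
  have xye : [set x; y] \subset e.
    by apply/subsetP => v /set2P[] ->.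
  have /cards1P[v vE] : #|e :\: [set x; y]| == 1%N.
    by rewrite cardsD (setIidPr xye) e3 cards2 (eq_sym x) yx.
  have : v \in e :\: [set x; y] by rewrite vE set11.
  rewrite !inE negb_or => /andP[/andP[vx vy] _].
  have eE : e = [set x; y; v] by rewrite -vE -{1}(setIidPr xye) setID.
  move: e0; rewrite {1}eE sumE // -wE addv_eq0 => /eqP/val_inj vw.
  by rewrite eE vw.
rewrite !inE !eqxx !orbT /= !andbT sumE // -wE addvv eqxx andbT.
by rewrite setUC cardsU1 !inE negb_or wx wy cards2 (eq_sym x) yx.
Qed.

Lemma color_range_line (x y w : vertex n) : y != x -> w != x -> w != y ->
  color_range f [set x; y; w] = seq_mset [:: f x; f y; f w].
Proof.
move=> yx wx wy; apply/eq_seq_msetP; rewrite -[[:: f x; _; _]]/(map f [:: x; y; w]).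
apply/perm_map/uniq_perm; rewrite ?enum_uniq //.
  by rewrite /= !inE negb_or (eq_sym x) yx (eq_sym x) wx (eq_sym y) wy.
by move=> v; rewrite mem_enum !inE orbA.
Qed.

(** Double counting of the pairs (e, y) with x and y distinct vertices of the
    edge e: each e contains two such y, which explains the factor 2. *)
Lemma incident_count (x : vertex n) M :
  (incident_color_ranges (subspace_hypergraph n) f x M * 2)%N
  = (\sum_b \sum_c (seq_mset [:: f x; b; c] == M) * joint_count b c (val x))%N.
Proof.
pose H := subspace_hypergraph n.
rewrite mset_countE big_distrl /=.
transitivity (\sum_(e in [set e in H | x \in e]) \sum_(y in e :\ x)
                (color_range f e == M))%N.
  apply: eq_bigr => e; rewrite !inE => /andP[/andP[/eqP e3 _] xe].
  rewrite sum_nat_const mulnC; congr (_ * _)%N.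
  by have := cardsD1 x e; rewrite e3 xe => -[].
rewrite (exchange_big_dep (fun y : vertex n => y != x)) /=; last first.
  by move=> e y _; rewrite !inE => /andP[].
transitivity (\sum_(y : vertex n | y != x)
    (seq_mset [:: f x; f y; col (val x + val y)%R] == M))%N.
  apply: eq_bigr => y yx; have [w wE lineE] := lineP yx.
  rewrite -wE (big_pred1 [set x; y; w]) => [|e]; last first.
    by rewrite /= -lineE !inE yx -andbA.
  have wx : w != x by rewrite -(inj_eq val_inj) wE addv_eql (valP y).
  have wy : w != y by rewrite -(inj_eq val_inj) wE addrC addv_eql (valP x).
  by rewrite color_range_line.
transitivity (\sum_(y | (y != 0%R) && (y != val x))
    (seq_mset [:: f x; col y; col (val x + y)%R] == M))%N.
  rewrite (reindex_omap (val : vertex n -> V) insub) => [|y /andP[y0 _]]; last first.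
    by rewrite insubT.
  apply: eq_bigl => y; rewrite valK eqxx andbT (inj_eq val_inj).
  by rewrite (valP y).
under [RHS]eq_bigr do under eq_bigr do rewrite /joint_count big_distrr /=.
under [RHS]eq_bigr do rewrite exchange_big /=.
rewrite exchange_big /=; apply: eq_bigr => y _.
rewrite (bigD1 (col y)) //= [X in (_ + X)%N]big1 => [|b /negPf bE]; last first.
  by rewrite big1 // => c _; rewrite [col y == b]eq_sym bE muln0.
rewrite (bigD1 (col (val x + y))) //= big1 => [|c /negPf cE]; last first.
  by rewrite [_ == c]eq_sym cE andbF muln0.
by rewrite !eqxx !addn0 muln1.
Qed.

Lemma perfect_coloring_joint_count :
  is_coloring f ->
  (forall x y, x != 0 -> y != 0 -> col x = col y ->
     forall b c, joint_count b c x = joint_count b c y) ->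
  perfect_coloring (subspace_hypergraph n) f.
Proof.
move=> fsurj count_col; split=> // x y fxy; apply/msetP => M.
apply/eqP; rewrite -(eqn_pmul2r (isT : 0 < 2)%N) !incident_count fxy; apply/eqP.
apply: eq_bigr => b _; apply: eq_bigr => c _.
by rewrite (count_col _ _ (valP x) (valP y) fxy).
Qed.

End Hypergraph.

(** * The coloring given by a strong bent partition *)

Section StrongColoring.
Variables (R : rcfType) (n K : nat) (U : {set 'rV['F_2]_n}).
Variable P : 'I_K -> {set 'rV['F_2]_n}.
Local Notation V := 'rV['F_2]_n.
Hypotheses (sbp : strong_bent_partition R U P) (U0 : 0 \in U).

Let nbp : normal_bent_partition R U P. Proof. by case: sbp. Qed.
Let partUP : is_partition U P. Proof. by case: nbp. Qed.

Lemma class0 : class P 0 = None.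
Proof. by apply/eqP; rewrite (classE partUP). Qed.

Lemma joint_count_indicator i j x :
  (joint_count (class P) (Some i) (Some j) x)%:R
  = \sum_y indicator R (P i) y * indicator R (P j) (x + y).
Proof.
rewrite natr_sum big_mkcond; apply: eq_bigr => y _.
rewrite !(indicator_class R partUP (Some _)) -natrM mulnb.
case: (eqVneq y 0) => [->|_] /=; first by rewrite class0.
by case: (eqVneq y x) => [->|_] //=; rewrite addvv class0 andbF.
Qed.

(** For two parts P i and P j this is [intersection_number].  If the counts
    with c = [Some j] depend only on the color of x, so does the one with
    c = [None], by subtraction from the total; symmetry in b and c gives the
    rest. *)
Lemma joint_count_class x x' : x != 0 -> x' != 0 -> class P x = class P x' ->
  forall b c, joint_count (class P) b c x = joint_count (class P) b c x'.
Proof.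
move=> x0 x'0 xx'; pose N := joint_count (class P).
have NSS i j : N (Some i) (Some j) x = N (Some i) (Some j) x'.
  apply/eqP; rewrite -(eqr_nat R) !joint_count_indicator.
  rewrite !(intersection_number sbp) // !(indicator_class R partUP (Some _)).
  by rewrite xx'.
have NSN b : (forall j, N b (Some j) x = N b (Some j) x') ->
    N b None x = N b None x'.
  move=> NbS; have sumN y : (\sum_c N b c y
      = N b None y + \sum_(c | c != None) N b c y)%N by rewrite (bigD1 None).
  have := sum_joint_count (class P) b x'0.
  rewrite -(sum_joint_count (class P) b x0) xx' => /eqP.
  rewrite eqn_add2r -/N !sumN.
  rewrite [X in _ == (_ + X)%N](eq_bigr (fun c => N b c x')) => [|[j|]//].
  by rewrite eqn_add2r eq_sym => /eqP.
move=> [i|] [j|]; rewrite -/N //; first exact: NSN.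
  by rewrite /N joint_countC [RHS]joint_countC; apply: NSN.
by apply: (NSN None) => j; rewrite /N joint_countC [RHS]joint_countC; apply: NSN.
Qed.

Lemma fourier_indicator0 (A : {set V}) :
  fourier (indicator R A) 0 = (Num.sqrt 2 ^+ n)^-1 * #|A|%:R.
Proof.
rewrite fourierE -sum1_card natr_sum [in RHS]big_mkcond; congr (_ * _).
apply: eq_bigr => y _; rewrite characterC character0r mulr1 /indicator.
by case: (y \in A).
Qed.

(** Some vertex must get the color [None], which fails if U = {0}.  At the zero
    vector the spectrum gives #|U| = m and #|P i| = m (m - 1) / K, and P i is
    nonempty, so m > 1. *)
Lemma card_linear_part : (0 < K)%N -> (1 < #|U|)%N.
Proof.
move=> K0; have m0 : 0 < Num.sqrt 2 ^+ n :> R := sqrt2n_gt0 R n.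
have zU := orthogonal_complement0 U; pose i := Ordinal K0.
have Pi0 : 0 < fourier (indicator R (P i)) 0.
  rewrite fourier_indicator0 mulr_gt0 ?invr_gt0 // ltr0n card_gt0.
  exact: (part_neq0 partUP (Some i)).
have := fourier_orthU nbp K0 zU; rewrite fourier_indicator0 mulrC => UE.
move: Pi0; rewrite (fourier_part_orth nbp) // eqxx mulr1 pmulr_rgt0; last first.
  by rewrite invr_gt0 ltr0n.
by rewrite subr_gt0 -(divr1_eq UE) ltr1n.
Qed.

Lemma is_coloring_class : (0 < K)%N -> is_coloring (partition_coloring P).
Proof.
move=> K0; have surj o v : v \in part U P o -> v != 0 ->
    exists x, partition_coloring P x = o.
  move=> vo v0; exists (Sub v v0); apply/eqP.
  by rewrite (partition_coloringE _ _ partUP).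
case=> [i|].
  have [v vi] := set0Pn _ (part_neq0 partUP (Some i)).
  apply: (surj _ v vi); apply/eqP => v0; move: vi.
  by rewrite -(classE partUP) v0 class0.
have : #|U :\ 0| != 0%N.
  by have := card_linear_part K0; rewrite (cardsD1 0) U0; case: #|_|.
rewrite cards_eq0 => /set0Pn[v]; rewrite !inE => /andP[v0 vU].
exact: (surj None v).
Qed.

End StrongColoring.

Theorem theorem9 (R : rcfType) (n k : nat) (U : {vspace 'rV['F_2]_n})
    (P : 'I_(2 ^ k) -> {set 'rV['F_2]_n}) :
  strong_bent_partition R [set x in U] P ->
  perfect_coloring (subspace_hypergraph n) (partition_coloring P).
Proof.
move=> sbp; have U0 : 0 \in [set x in U] by rewrite inE mem0v.
apply: (@perfect_coloring_joint_count n _ (class P)).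
  by apply: (is_coloring_class sbp U0); rewrite expn_gt0.
exact: joint_count_class sbp U0.
Qed.
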